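(* Let $F$ be a finite field with $|F|=q=p^e$, where $p$ is a prime and $e\ge1$, let $V$ be a $d$-dimensional vector space over $F$, and let $n\ge 1$. (1) If $n<5$ then $\mathcal P^t_n(V)\cap\mathcal P^{\equiv}_n(V)$ consists of homogeneous polynomials of degree $n$. (2) If $n\ge\max\{5,q\}$, $e\ge 2$ and $d\ge n$, then $\mathcal P^t_n(V)\cap\mathcal P^{\equiv}_n(V)$ does not consist only of homogeneous polynomials of degree $n$.
   Context: For a map $\alpha:V\to F$ with $\alpha(0)=0$ and $n\ge 1$, the $n$th defect $\Delta^n\alpha:V^n\to F$ is $\Delta^n\alpha(u_1,\dots,u_n)=\sum_{1\le i_1<\cdots<i_m\le n}(-1)^{n-m}\alpha(u_{i_1}+\cdots+u_{i_m})$, the sum being over all nonempty subsets $\{i_1,\dots,i_m\}$ of $\{1,\dots,n\}$. The combinatorial degree $\mathrm{cdeg}(\alpha)$ is the positive integer $n$ with $\Delta^n\alpha\ne 0$ and $\Delta^{n+1}\alpha=0$ (if it exists); $\mathrm{cdeg}(0)=-1$. A polynomial in $F[x_1,\dots,x_d]$ is reduced if every exponent of every variable in every monomial occurring with nonzero coefficient is less than $|F|$. A map $\alpha:V\to F$ is a polynomial mapping if for a basis $e_1,\dots,e_d$ there is $f\in F[x_1,\dots,x_d]$ with $\alpha(\sum a_ie_i)=f(a_1,\dots,a_d)$ for all $a_i\in F$; $f$ is said to realize $\alpha$, and there is a unique reduced $f$ realizing $\alpha$ with respect to the given basis. A monomial of $\alpha$ is a polynomial mapping $\beta$ realized by a monomial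 (with its nonzero coefficient) of the reduced polynomial realizing $\alpha$; $\deg(\beta)$ is the total degree of that reduced monomial, and $\beta$ is totally reduced if all exponents of that monomial are less than $\mathrm{char}(F)=p$. The following sets of polynomial mappings $V\to F$ are defined with respect to one, equivalently any, basis of $V$: $\mathcal P_n(V)=\{\alpha:\ \mathrm{cdeg}(\alpha)\le n,\ \alpha(0)=0\}$; $\mathcal P^t_n(V)=\{\alpha\in\mathcal P_n(V):$ all monomials $\beta$ of $\alpha$ with $\mathrm{cdeg}(\beta)=n$ are totally reduced$\}$; $\mathcal P^{\equiv}_n(V)=\{\alpha:$ all monomials $\beta$ of $\alpha$ satisfy $0\ne\deg(\beta)\equiv n \pmod{|F|-1}\}$. A polynomial mapping $\alpha:V\to F$ is called a homogeneous polynomial of degree $n$ if, with respect to some (equivalently every) basis of $V$, it is realized by a homogeneous polynomial of degree $n$ that is not required to be reduced (the zero map counts as such). *)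

(* Defs.v *)
From HB Require Import structures.
From mathcomp Require Import all_boot all_order all_algebra all_field.
From mathcomp Require Import mpoly.

Set Implicit Arguments.
Unset Strict Implicit.
Unset Printing Implicit Defensive.

Import Order.TTheory GRing.Theory Num.Theory.
Local Open Scope ring_scope.

Section PolynomialMappings.

Variables (F : finFieldType) (V : vectType F).
Implicit Types (alpha beta : V -> F) (n : nat).

Local Notation dim := (\dim {:V}).

Definition defect n alpha (u : 'I_n -> V) : F :=
  \sum_(I : {set 'I_n} | I != set0)
     (-1) ^+ (n - #|I|) * alpha (\sum_(i in I) u i).

(* The combinatorial degree is a partial function of alpha, so it is given by
   its graph; it is only meant for maps with alpha 0 = 0. *)
Definition is_cdeg alpha (c : int) : Prop :=
  (alpha =1 (fun=> 0) /\ c = -1) \/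
  (exists n, [/\ (0 < n)%N, c = n%:Z,
                 exists u : 'I_n -> V, defect alpha u != 0 &
                 forall u : 'I_n.+1 -> V, defect alpha u = 0]).

Definition reduced (f : {mpoly F[dim]}) : Prop :=
  forall m, m \in msupp f -> forall i, (m i < #|F|)%N.

Definition realizes (b : dim.-tuple V) (f : {mpoly F[dim]}) alpha : Prop :=
  forall a : 'I_dim -> F, alpha (\sum_i a i *: tnth b i) = f.@[a].

Definition polynomial_mapping alpha : Prop :=
  exists b : dim.-tuple V, basis_of {:V} b /\ exists f, realizes b f alpha.

(* beta is the monomial of alpha, relative to the basis b, whose exponent
   vector in the reduced polynomial realizing alpha is m; then
   deg beta = mdeg m. *)
Definition monomial_of (b : dim.-tuple V) alpha (m : 'X_{1..dim}) beta : Prop :=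
  exists f, [/\ reduced f, realizes b f alpha, m \in msupp f &
                realizes b (f@_m *: 'X_[m]) beta].

(* [pchar F] has exactly one element, the characteristic of F. *)
Definition totally_reduced (m : 'X_{1..dim}) : Prop :=
  forall p, p \in [pchar F] -> forall i, (m i < p)%N.

Definition Pn n alpha : Prop :=
  [/\ polynomial_mapping alpha, alpha 0 = 0 &
      exists c, is_cdeg alpha c /\ c <= n%:Z].

Definition Pt n alpha : Prop :=
  Pn n alpha /\
  exists b : dim.-tuple V, basis_of {:V} b /\
    forall m beta, monomial_of b alpha m beta ->
      is_cdeg beta n%:Z -> totally_reduced m.

Definition Pequiv n alpha : Prop :=
  polynomial_mapping alpha /\
  exists b : dim.-tuple V, basis_of {:V} b /\
    forall m beta, monomial_of b alpha m beta ->
      mdeg m <> 0%N /\ (mdeg m = n %[mod #|F| - 1])%N.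

Definition homogeneous_polynomial n alpha : Prop :=
  exists b : dim.-tuple V, basis_of {:V} b /\
    exists f : {mpoly F[dim]}, f \is n.-homog /\ realizes b f alpha.

End PolynomialMappings.

(* Main.v *)
Require Import Defs.
From HB Require Import structures.
From mathcomp Require Import all_boot all_order all_algebra all_field.
From mathcomp Require Import mpoly.
From mathcomp Require Import zify.
From Stdlib Require Import Classical_Prop.

Set Implicit Arguments.
Unset Strict Implicit.
Unset Printing Implicit Defensive.

Import Order.TTheory GRing.Theory Num.Theory.
Local Open Scope ring_scope.

(** Write q = p ^ e.  The weight of a reduced monomial is the sum of the base p
   digit sums of its exponents.  Two facts about it carry the proof.

   - A monomial of weight w is a product of w additive maps, namely of
     Frobenius powers of coordinates ([prod_factors]).  Expanding such a
     product over the subset sums in the defect leaves only terms that miss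
     one of the arguments, and these cancel, as soon as there are more than w
     arguments ([defect_prod], [defect_monomial]).
   - Conversely, if the (k + 1)-st defect of alpha vanishes, then all monomials
     of alpha have weight at most k ([weight_le_defect]).  By induction on k:
     polarizing alpha in the direction t * b_i removes one argument from the
     defect ([defectS]), and the coefficient of t ^ (p ^ a) in the result has,
     at the monomial m / x_i ^ (p ^ a), the coefficient of m in alpha times a
     binomial coefficient ([coefm_along]).  When p ^ a is the exact power of p
     dividing the exponent of x_i in m, this binomial coefficient is non-zero
     modulo p and the weight drops by one ([bin_pfactor_neq0], [weight_peel]).

   Together they say that a monomial has combinatorial degree equal to its
   weight ([cdeg_monomial]).  Coefficients of reduced polynomials are handled
   as linear functionals [coefm] on functions: the functionals dual to the
   reduced monomials are products of the one-variable functionals [dual], which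
   gives existence and uniqueness of reduced polynomials at once.

   The conditions on alpha may be stated in two different bases.  Congruences
   of degrees are transported through a characterization without basis: they
   hold exactly when alpha (c *: v) = c ^+ n * alpha v ([scaling_of_Pequiv],
   [degree_of_scaling]).

   For n < 5, a monomial of weight n of alpha is totally reduced, so its degree
   equals its weight n.  A monomial of smaller weight has degree at most n,
   since the next degree allowed by the congruence is too large for so few
   powers of p ([sum_powers_le]).  A non-constant monomial of degree at most n
   and congruent to n modulo q - 1 is realized in degree n: multiply it by a
   power of x_i ^ (q - 1), for a variable x_i that occurs in it
   ([homogeneous_low_degree]).

   For n >= max(5, q), e >= 2 and d >= n, a product of n - p + 1 distinct
   variables raised to suitable powers of p has weight n - p + 1 < n and degree
   n + q - 1 ([mdeg_high_mon], [weight_high_mon]).  It belongs to both classes.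
   It is not homogeneous of degree n, because a linear change of variables
   preserves homogeneity and reducing exponents never raises the degree, so
   reduced monomials of a homogeneous map of degree n have degree at most n
   ([homogeneous_coef]). *)

(** * Coefficients of functions on a finite field *)

Section OneVariable.

Variable F : finFieldType.
Implicit Types (a x y z : F) (f g : {poly F}).

Lemma ffcard_gt0 : (0 < #|F|)%N.
Proof. exact: ltnW (finNzRing_gt1 F). Qed.

Lemma ffcard_pred_gt0 : (0 < #|F|.-1)%N.
Proof. by rewrite -subn1 subn_gt0 finNzRing_gt1. Qed.

Lemma poly_eq_fun f g :
  (size f <= #|F|)%N -> (size g <= #|F|)%N -> (forall x, f.[x] = g.[x]) ->
  f = g.
Proof.
move=> szf szg efg; apply/eqP; rewrite -subr_eq0; apply/eqP.
apply: (@roots_geq_poly_eq0 _ _ (enum F)); rewrite ?enum_uniq //.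
  by apply/allP=> x _; rewrite rootE hornerD hornerN efg subrr.
rewrite -cardE (leq_trans (size_polyD _ _)) // size_polyN geq_max.
by rewrite szf szg.
Qed.

Definition point_poly a : {poly F} := 1 - ('X - a%:P) ^+ #|F|.-1.

Lemma size_point_poly a : (size (point_poly a) <= #|F|)%N.
Proof.
rewrite (leq_trans (size_polyD _ _)) // size_polyN geq_max size_poly1.
by rewrite size_exp_XsubC prednK ?leqnn ?andbT // ffcard_gt0.
Qed.

Lemma expf_card_pred x : x != 0 -> x ^+ #|F|.-1 = 1.
Proof.
move=> x0; apply: (mulfI x0); rewrite -exprS prednK ?ffcard_gt0 // mulr1.
exact: expf_card.
Qed.

Lemma horner_point_poly a x : (point_poly a).[x] = (x == a)%:R.
Proof.
rewrite /point_poly !(hornerE, horner_exp) /= -[x == a]subr_eq0.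
have [->|xa] := eqVneq (x - a) 0; last by rewrite expf_card_pred ?subrr.
by rewrite expr0n gtn_eqF ?ffcard_pred_gt0 // subr0.
Qed.

(** The reduced polynomial of a function g on F is the sum of the
   [g a *: point_poly a], so [dual k] is the kernel of the linear functional
   that reads off its k-th coefficient. *)
Definition dual (k : nat) a : F := (point_poly a)`_k.

Lemma sum_dual a x : \sum_(k < #|F|) dual k a * x ^+ k = (x == a)%:R.
Proof.
by rewrite -horner_point_poly (horner_coef_wide _ (size_point_poly a)).
Qed.

Lemma dual_expr (j k : nat) :
  (k < #|F|)%N -> \sum_a dual j a * a ^+ k = (j == k)%:R.
Proof.
move=> ltk; rewrite -coefXn.
have -> : 'X^k = \sum_a a ^+ k *: point_poly a.
  apply: poly_eq_fun; first by rewrite size_polyXn.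
    apply: (leq_trans (size_sum _ _ _)); apply/bigmax_leqP=> a _.
    exact: leq_trans (size_scale_leq _ _) (size_point_poly a).
  move=> x; rewrite hornerXn horner_sum (bigD1 x) //= big1 ?addr0 => [|a ax].
    by rewrite hornerZ horner_point_poly eqxx mulr1.
  by rewrite hornerZ horner_point_poly eq_sym (negPf ax) mulr0.
by rewrite coef_sum; apply: eq_bigr=> a _; rewrite coefZ mulrC.
Qed.

Lemma dual_shift (s : nat) z y :
  dual s (z - y) = \sum_(k < #|F|) dual k z * ('C(k, s)%:R * y ^+ (k - s)).
Proof.
have -> : dual s (z - y) = (point_poly z \Po ('X + y%:P))`_s.
  rewrite /dual /point_poly comp_polyB comp_polyC rmorphXn /= comp_polyB.
  by rewrite comp_polyX comp_polyC polyCB opprB addrA.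
rewrite comp_polyE.
rewrite (big_ord_widen _ (fun k => (point_poly z)`_k *: ('X + y%:P) ^+ k)
           (size_point_poly z)) coef_sum.
rewrite big_mkcond /=; apply: eq_bigr=> k _.
rewrite /dual; case: ltnP=> [lek|/(nth_default 0) ->]; last by rewrite mul0r.
rewrite coefZ; congr (_ * _); rewrite addrC exprDn coef_sum.
have [lesk|ltks] := leqP s k; last first.
  rewrite bin_small // mul0r big1 // => i _.
  rewrite coefMn -rmorphXn coefCM coefXn (gtn_eqF (leq_ltn_trans _ ltks)).
    by rewrite mulr0 mul0rn.
  by rewrite -ltnS.
rewrite (bigD1 (inord s)) //= inordK ?ltnS // big1 ?addr0.
  by rewrite coefMn -rmorphXn coefCM coefXn eqxx mulr1 mulr_natl.
move=> i neq; rewrite coefMn -rmorphXn coefCM coefXn.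
case: eqP=> [eis|_]; last by rewrite mulr0 mul0rn.
by case/eqP: neq; apply: val_inj; rewrite /= inordK ?ltnS.
Qed.

(** This is the expansion of (y + t) ^ (j + s) seen on functionals: in the
   function (y, t) |-> g (y + t), the coefficient of y ^ j * t ^ s is the
   binomial coefficient times the coefficient of z ^ (j + s) in g. *)
Lemma dual_convolution (j s : nat) z : (j + s < #|F|)%N ->
  \sum_t dual s t * dual j (z - t) = 'C(j + s, s)%:R * dual (j + s) z.
Proof.
move=> ltjs; pose h t := z - t.
have hK : involutive h by move=> t; rewrite /h opprB addrC subrK.
rewrite (reindex_inj (inv_inj hK)) /=.
transitivity (\sum_(k < #|F|) dual k z * ('C(k, s)%:R *
               \sum_t dual j t * t ^+ (k - s))).
  transitivity (\sum_t \sum_(k < #|F|)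
      dual k z * ('C(k, s)%:R * t ^+ (k - s)) * dual j t).
    apply: eq_bigr=> t _; rewrite -[z - h t]/(h (h t)) hK /h dual_shift.
    by rewrite mulr_suml.
  rewrite exchange_big; apply: eq_bigr=> k _ /=.
  rewrite mulrA mulr_sumr; apply: eq_bigr=> t _.
  by rewrite !mulrA mulrAC.
rewrite (bigD1 (Ordinal ltjs)) //= [X in _ + X]big1 ?addr0 => [|k neq].
  rewrite addnK dual_expr ?eqxx ?mulr1 1?mulrC //.
  exact: leq_ltn_trans (leq_addr _ _) ltjs.
rewrite dual_expr; last exact: leq_ltn_trans (leq_subr _ _) (ltn_ord k).
have [ltks|lesk] := ltnP k s; first by rewrite bin_small // mul0r mulr0.
case: eqP=> [ejk|_]; last by rewrite !mulr0.
by case/eqP: neq; apply: val_inj; rewrite /= ejk subnK.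
Qed.

(** The exponent in [1, |F| - 1] of the same function x |-> x ^ k, for k > 0;
   the exponent 0 is kept apart because 0 ^ 0 = 1. *)
Definition redexp (k : nat) : nat :=
  if k is k'.+1 then (k' %% #|F|.-1).+1 else 0.

Lemma redexp_lt k : (redexp k < #|F|)%N.
Proof.
case: k => [|k] /=; first exact: ffcard_gt0.
by rewrite -[ltnRHS](prednK ffcard_gt0) ltnS ltn_pmod // ffcard_pred_gt0.
Qed.

Lemma redexp_le k : (redexp k <= k)%N.
Proof. by case: k => //= k; rewrite ltnS leq_mod. Qed.

Lemma redexp_small k : (k < #|F|)%N -> redexp k = k.
Proof.
by case: k => //= k ltk; rewrite modn_small // -ltnS prednK ?ffcard_gt0.
Qed.

Lemma exprMpred x k j : (0 < k)%N -> x ^+ (k + j * #|F|.-1) = x ^+ k.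
Proof.
move=> k0; rewrite exprD mulnC exprM.
have [->|x0] := eqVneq x 0; first by rewrite expr0n gtn_eqF ?mul0r.
by rewrite expf_card_pred // expr1n mulr1.
Qed.

Lemma expr_redexp x k : x ^+ redexp k = x ^+ k.
Proof.
case: k => //= k; rewrite {2}(divn_eq k #|F|.-1) addnC -addSn.
by rewrite exprMpred.
Qed.

Lemma expr_modP (k j : nat) : (0 < k)%N -> (0 < j)%N ->
  (forall x, x ^+ k = x ^+ j) <-> (k = j %[mod #|F| - 1])%N.
Proof.
case: k => // k; case: j => // j _ _; rewrite subn1; split=> [ekj|].
  have : 'X^(redexp k.+1) = 'X^(redexp j.+1) :> {poly F}.
    apply: poly_eq_fun; rewrite ?size_polyXn ?redexp_lt // => x.
    by rewrite !hornerXn !expr_redexp.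
  move/(congr1 (fun f : {poly F} => size f)); rewrite !size_polyXn => -[/= e].
  by apply/eqP; rewrite -addn1 -(addn1 j) eqn_modDr e.
move/eqP; rewrite -addn1 -(addn1 j) eqn_modDr !addn1 => /eqP ekj x.
by rewrite -(expr_redexp x k.+1) -(expr_redexp x j.+1) /= ekj.
Qed.

End OneVariable.

Section ManyVariables.

Variables (F : finFieldType) (d : nat).
Local Notation point := {ffun 'I_d -> F}.
Implicit Types (g h : point -> F) (m mu : 'X_{1..d}) (a x : point).

Definition bounded_exps m := forall i, (m i < #|F|)%N.

Definition dualm m a : F := \prod_i dual (m i) (a i).

Definition coefm m g : F := \sum_a dualm m a * g a.

Lemma eq_coefm m g h : g =1 h -> coefm m g = coefm m h.
Proof. by move=> egh; apply: eq_bigr=> a _; rewrite egh. Qed.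

Lemma coefmD m g h : coefm m (fun a => g a + h a) = coefm m g + coefm m h.
Proof. by rewrite -big_split; apply: eq_bigr=> a _ /=; rewrite mulrDr. Qed.

Lemma coefmZ m c g : coefm m (fun a => c * g a) = c * coefm m g.
Proof. by rewrite mulr_sumr; apply: eq_bigr=> a _; rewrite mulrCA. Qed.

Lemma coefm_sum m (I : Type) (r : seq I) (g : I -> point -> F) :
  coefm m (fun a => \sum_(k <- r) g k a) = \sum_(k <- r) coefm m (g k).
Proof. by rewrite exchange_big; apply: eq_bigr=> a _ /=; rewrite mulr_sumr. Qed.

Definition redm mu : 'X_{1..d} := [multinom redexp F (mu i) | i < d].

Lemma redm_id mu : bounded_exps mu -> redm mu = mu.
Proof. by move=> bmu; apply/mnmP=> i; rewrite mnmE (redexp_small (bmu i)). Qed.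

Lemma mdeg_redm mu : (mdeg (redm mu) <= mdeg mu)%N.
Proof. by rewrite !mdegE; apply: leq_sum=> i _; rewrite mnmE redexp_le. Qed.

Lemma coefm_monomial m mu :
  coefm m (fun a => \prod_i a i ^+ mu i) = (m == redm mu)%:R.
Proof.
transitivity (\prod_i \sum_(y : F) dual (m i) y * y ^+ redexp F (mu i)).
  rewrite bigA_distr_bigA; apply: eq_bigr=> a _; rewrite -big_split.
  by apply: eq_bigr=> i _ /=; rewrite expr_redexp.
under eq_bigr => i _ do rewrite dual_expr ?(redexp_lt F) //.
have [->|neq] := eqVneq m (redm mu).
  by rewrite big1 // => i _; rewrite mnmE eqxx.
have [i neqi] : exists i, m i != redexp F (mu i).
  apply/existsP; rewrite -negb_forall; apply: contra neq => /forallP emu.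
  by apply/eqP/mnmP=> i; rewrite mnmE; apply/eqP/emu.
by rewrite (bigD1 i) //= (negPf neqi) mul0r.
Qed.

Lemma coefm_meval m (f : {mpoly F[d]}) :
  coefm m (fun a => f.@[a]) = \sum_(mu <- msupp f) f@_mu * (m == redm mu)%:R.
Proof.
rewrite (eq_coefm _ (fun a => mevalE a f)) coefm_sum.
by apply: eq_bigr=> mu _; rewrite coefmZ coefm_monomial.
Qed.

Lemma coefm_bounded m (f : {mpoly F[d]}) :
  {in msupp f, forall mu, bounded_exps mu} ->
  coefm m (fun a => f.@[a]) = f@_m.
Proof.
move=> bf; rewrite coefm_meval [in RHS](mpolyE f) raddf_sum /=.
rewrite big_seq [RHS]big_seq; apply: eq_bigr=> mu muf.
by rewrite redm_id ?mcoeffZ ?mcoeffX 1?eq_sym //; apply: bf.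
Qed.

(** Lagrange interpolation, expanded into reduced monomials. *)
Definition interpolant g : {mpoly F[d]} :=
  \sum_(c : {ffun 'I_d -> 'I_#|F|})
     coefm [multinom val (c i) | i < d] g *: 'X_[[multinom val (c i) | i < d]].

Lemma interpolant_bounded g :
  {in msupp (interpolant g), forall mu, bounded_exps mu}.
Proof.
move=> mu; rewrite mcoeff_msupp => nz i; rewrite ltnNge.
apply: contra nz => lei; apply/eqP; rewrite raddf_sum big1 // => c _ /=.
rewrite mcoeffZ mcoeffX; case: eqP=> [e|_]; last by rewrite mulr0.
by move: lei; rewrite -e mnmE leqNgt ltn_ord.
Qed.

Lemma interpolantE g x : (interpolant g).@[x] = g x.
Proof.
rewrite raddf_sum /=.
transitivity (\sum_a g a * \prod_i \sum_(k < #|F|) dual k (a i) * x i ^+ k).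
  under [RHS]eq_bigr => a _ do rewrite bigA_distr_bigA mulr_sumr.
  rewrite [RHS]exchange_big; apply: eq_bigr=> c _ /=.
  rewrite mevalZ mevalX mulr_suml; apply: eq_bigr=> a _.
  rewrite mulrAC mulrC; congr (_ * _); rewrite -big_split.
  by apply: eq_bigr=> i _ /=; rewrite mnmE.
rewrite (bigD1 x) //= [X in _ + X]big1 ?addr0 => [|a neq].
  by rewrite big1 ?mulr1 // => i _; rewrite sum_dual eqxx.
have [i neqi] : exists i, x i != a i.
  apply/existsP; rewrite -negb_forall; apply: contra neq => /forallP e.
  by apply/eqP/ffunP=> i; apply/esym/eqP.
by rewrite (bigD1 i) //= sum_dual (negPf neqi) mul0r mulr0.
Qed.

Definition along (i : 'I_d) (t : F) : point := [ffun j => if j == i then t else 0].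

Lemma coefm_along m (i : 'I_d) (s : nat) g : (m i + s < #|F|)%N ->
  \sum_t dual s t * coefm m (fun a => g (a + along i t)) =
  'C(m i + s, s)%:R * coefm (m + U_(i) *+ s)%MM g.
Proof.
move=> lts.
transitivity (\sum_t \sum_(a : point) dual s t * dualm m (a - along i t) * g a).
  apply: eq_bigr=> t _; rewrite mulr_sumr.
  rewrite (reindex (fun a : point => a - along i t)) /=.
    by apply: eq_bigr=> a _; rewrite subrK mulrA.
  by exists (fun a : point => a + along i t) => a _; rewrite ?subrK ?addrK.
rewrite exchange_big mulr_sumr; apply: eq_bigr=> a _ /=.
rewrite -mulr_suml mulrA; congr (_ * _).
rewrite /dualm (bigD1 i) //= mulrA mnmDE mulmnE mnm1E eqxx mul1n.
rewrite -dual_convolution // mulr_suml; apply: eq_bigr=> t _.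
rewrite (bigD1 i) //= mulrA !ffunE eqxx; congr (_ * _).
apply: eq_bigr=> j ji; rewrite !ffunE (negPf ji) subr0.
by rewrite mnmDE mulmnE mnm1E eq_sym (negPf ji) addn0.
Qed.

End ManyVariables.

(** * Defects *)

Section Defects.

Variables (F : finFieldType) (V : vectType F).
Implicit Types (alpha beta : V -> F) (n : nat).

(** The defect with the empty set included among the index sets, so that it
   splits along one argument without boundary terms. *)
Definition full_defect n alpha (u : 'I_n -> V) : F :=
  \sum_(I : {set 'I_n}) (-1) ^+ (n - #|I|) * alpha (\sum_(i in I) u i).

Lemma defectE n alpha (u : 'I_n -> V) :
  defect alpha u = full_defect alpha u - (-1) ^+ n * alpha 0.
Proof.
rewrite /full_defect (bigD1 set0) //= cards0 subn0 big_set0.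
by rewrite addrAC subrr add0r.
Qed.

Lemma sum_set_recl n (G : {set 'I_n.+1} -> F) :
  \sum_I G I = \sum_(J : {set 'I_n})
     (G (lift ord0 @: J) + G (ord0 |: lift ord0 @: J)).
Proof.
have up0 (J : {set 'I_n}) : ord0 \notin lift ord0 @: J.
  by apply/imsetP=> -[j _ e]; have := neq_lift ord0 j; rewrite -e eqxx.
have upK (J : {set 'I_n}) : lift ord0 @^-1: (lift ord0 @: J) = J.
  by apply/setP=> j; rewrite inE mem_imset //; apply: lift_inj.
have mem_up (I : {set 'I_n.+1}) j :
  (lift ord0 j \in lift ord0 @: (lift ord0 @^-1: I)) = (lift ord0 j \in I).
  by rewrite mem_imset ?inE //; apply: lift_inj.
rewrite (bigID (fun I : {set _} => ord0 \in I)) /= addrC big_split /=.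
congr (_ + _).
  rewrite (reindex_onto (fun J : {set 'I_n} => lift ord0 @: J)
             (fun I => lift ord0 @^-1: I)) /= => [|I I0].
    by apply: eq_bigl=> J; rewrite up0 upK eqxx.
  apply/setP=> i; case: (unliftP ord0 i) => [j ->|->]; first exact: mem_up.
  by rewrite (negPf I0) (negPf (up0 _)).
rewrite (reindex_onto (fun J : {set 'I_n} => ord0 |: lift ord0 @: J)
           (fun I => lift ord0 @^-1: I)) /= => [|I I0].
  apply: eq_bigl=> J; rewrite !inE eqxx /=; apply/eqP/setP=> j.
  by rewrite !inE /= mem_imset //; apply: lift_inj.
apply/setP=> i; case: (unliftP ord0 i) => [j ->|->]; last first.
  by rewrite !inE eqxx I0.
by rewrite in_setU1 mem_up.
Qed.

Definition shift_diff (u : V) alpha (x : V) : F := alpha (u + x) - alpha x.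

Lemma full_defectS n alpha (u : 'I_n.+1 -> V) :
  full_defect alpha u =
  full_defect (shift_diff (u ord0) alpha) (fun i => u (lift ord0 i)).
Proof.
rewrite /full_defect sum_set_recl; apply: eq_bigr=> J _.
have cardJ : #|lift ord0 @: J| = #|J| by rewrite card_imset //; apply: lift_inj.
have nJ0 : ord0 \notin lift ord0 @: J.
  by apply/imsetP=> -[j _ e]; have := neq_lift ord0 j; rewrite -e eqxx.
have leJ : (#|J| <= n)%N by rewrite -[n in leqRHS]card_ord max_card.
rewrite cardsU1 nJ0 cardJ add1n subSS subSn // exprS mulN1r.
rewrite big_setU1 //= big_imset /=; last by move=> i j _ _; apply: lift_inj.
by rewrite mulNr /shift_diff mulrBr [RHS]addrC.
Qed.

Lemma full_defect_const n c (u : 'I_n.+1 -> V) :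
  full_defect (fun=> c) u = 0.
Proof.
rewrite full_defectS /full_defect big1 // => I _.
by rewrite /shift_diff subrr mulr0.
Qed.

Definition polar (u : V) alpha (x : V) : F := alpha (u + x) - alpha x - alpha u.

(** Defects are iterated polarizations; this is what makes induction on the
   combinatorial degree possible. *)
Lemma defectS n alpha (u : 'I_n.+2 -> V) :
  defect alpha u = defect (polar (u ord0) alpha) (fun i => u (lift ord0 i)).
Proof.
have polarE (w : 'I_n.+1 -> V) : full_defect (polar (u ord0) alpha) w =
    full_defect (shift_diff (u ord0) alpha) w.
  apply/eqP; rewrite -subr_eq0 -oppr_eq0 opprB.
  rewrite -[X in _ == X](full_defect_const (alpha (u ord0)) w) /full_defect.
  rewrite -sumrB; apply/eqP/eq_bigr=> I _; rewrite -mulrBr; congr (_ * _).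
  by rewrite /polar /shift_diff subKr.
rewrite !defectE full_defectS polarE; congr (_ - _).
by rewrite /polar addr0 addrAC subrr add0r exprS mulN1r mulrN mulNr.
Qed.

Lemma defect1 alpha (u : 'I_1 -> V) : defect alpha u = alpha (u ord0).
Proof.
rewrite defectE full_defectS /full_defect (bigD1 set0) //= [X in _ + X - _]big1.
  rewrite cards0 big_set0 /shift_diff !addr0 expr0 expr1 mul1r mulN1r.
  by rewrite opprK subrK.
by move=> I; case/set0Pn => -[].
Qed.

Section ProductOfAdditive.

Variables (T : Type) (l : T -> V -> F) (n : nat) (u : 'I_n -> V).
Hypothesis ladd : forall t, {morph l t : x y / x + y}.

Lemma additive_map0 t : l t 0 = 0.
Proof. by apply: (addIr (l t 0)); rewrite -ladd !add0r. Qed.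

Lemma sum_sign_supset (J : {set 'I_n}) : J != setT ->
  \sum_(I : {set 'I_n} | J \subset I) (-1) ^+ #|I| = 0 :> F.
Proof.
rewrite -subTset => /subsetPn[x _ xJ].
rewrite (bigID (fun I : {set _} => x \in I)) /=.
rewrite (reindex_onto (fun I => x |: I) (fun I => I :\ x)) /=; last first.
  by move=> I /andP[_ xI]; rewrite setD1K.
rewrite (eq_bigl (fun I : {set _} => (J \subset I) && (x \notin I))); last first.
  move=> I; rewrite setU11 andbT; have [xI|xI] /= := boolP (x \in I).
    rewrite andbF; apply/negbTE/nandP; right.
    by apply: contraTneq xI => <-; rewrite !inE eqxx.
  rewrite setU1K // eqxx !andbT -subDset.
  suff -> : J :\: [set x] = J by [].
  by apply/setDidPl; rewrite disjoint_sym disjoints1.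
rewrite -big_split big1 // => I /andP[_ xI] /=.
by rewrite cardsU1 xI exprS mulN1r addNr.
Qed.

(** Expanding each additive factor over I trades it for one more index that
   I has to contain. *)
Lemma sum_sign_prod (s : seq T) (J : {set 'I_n}) : (#|J| + size s < n)%N ->
  \sum_(I : {set 'I_n} | J \subset I)
     (-1) ^+ #|I| * \prod_(t <- s) l t (\sum_(i in I) u i) = 0.
Proof.
elim: s J => [|t s IHs] J ltJ.
  under eq_bigr => I _ do rewrite big_nil mulr1.
  apply: sum_sign_supset; apply: contraTneq ltJ => ->.
  by rewrite cardsT card_ord addn0 ltnn.
have lsum (I : {set 'I_n}) : l t (\sum_(i in I) u i) = \sum_(i in I) l t (u i).
  exact: (big_morph (l t) (ladd t) (additive_map0 t)).
transitivity (\sum_i l t (u i) * \sum_(I : {set 'I_n} | i |: J \subset I)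
     (-1) ^+ #|I| * \prod_(t <- s) l t (\sum_(i in I) u i)).
  transitivity (\sum_(I : {set 'I_n} | J \subset I) \sum_(i in I)
      l t (u i) * ((-1) ^+ #|I| * \prod_(t <- s) l t (\sum_(i in I) u i))).
    apply: eq_bigr=> I _; rewrite big_cons lsum -mulr_suml.
    by rewrite mulrCA.
  rewrite (exchange_big_dep predT) //=; apply: eq_bigr=> i _.
  rewrite mulr_sumr; apply: eq_bigl=> I.
  by rewrite subUset sub1set andbC.
rewrite big1 // => i _; rewrite IHs ?mulr0 //; apply: leq_ltn_trans ltJ.
by rewrite /= addnS -addSn leq_add2r cardsU1; case: (_ \notin _).
Qed.

Lemma defect_prod c (s : seq T) : (0 < size s < n)%N ->
  defect (fun v => c * \prod_(t <- s) l t v) u = 0.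
Proof.
move=> /andP[s0 sn]; rewrite defectE.
have -> : \prod_(t <- s) l t 0 = 0.
  by case: s s0 {sn} => // t s _; rewrite big_cons additive_map0 mul0r.
rewrite !mulr0 subr0.
transitivity ((-1) ^+ n * c * \sum_(I : {set 'I_n} | set0 \subset I)
     (-1) ^+ #|I| * \prod_(t <- s) l t (\sum_(i in I) u i)); last first.
  by rewrite sum_sign_prod ?cards0 ?mulr0.
rewrite mulr_sumr; apply: eq_big=> [I|I _]; first by rewrite sub0set.
have leI : (#|I| <= n)%N by rewrite -[n in leqRHS]card_ord max_card.
rewrite !mulrA; congr (_ * _); rewrite mulrAC; congr (_ * _).
have -> : (-1) ^+ n = (-1) ^+ (n - #|I|) * (-1) ^+ #|I| :> F.
  by rewrite -exprD subnK.
by rewrite -mulrA -expr2 sqrr_sign mulr1.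
Qed.

End ProductOfAdditive.

End Defects.

(** * Decomposition of exponents into powers of p *)

Section PowerDecomposition.

Variable p : nat.
Hypothesis p_pr : prime p.

Let p_gt0 : (0 < p)%N := prime_gt0 p_pr.

Fixpoint ppow_rec (fuel k : nat) : seq nat :=
  if fuel is fuel'.+1 then
    if k == 0%N then [::] else logn p k :: ppow_rec fuel' (k - p ^ logn p k)
  else [::].

(** The exponents of the powers of p that add up to k in base p, each one as
   often as its digit says; they are found by peeling off the lowest power, so
   the length of [ppow k] is the digit sum of k. *)
Definition ppow (k : nat) : seq nat := ppow_rec k k.

Lemma ppow_rec_fuel fuel k : (k <= fuel)%N -> ppow_rec fuel k = ppow k.
Proof.
rewrite /ppow; have [n] := ubnP fuel; elim: n fuel k => // n IHn [|f] [|k] //=.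
rewrite !ltnS => ltfn lekf; congr (_ :: _).
have le1 : (k.+1 - p ^ logn p k.+1 <= k)%N.
  by rewrite leq_subLR -add1n leq_add2r expn_gt0 p_gt0.
rewrite !IHn //; first exact: leq_ltn_trans lekf ltfn.
exact: leq_trans le1 lekf.
Qed.

Lemma ppowE k : (0 < k)%N -> ppow k = logn p k :: ppow (k - p ^ logn p k).
Proof.
case: k => // k _; rewrite {1}/ppow /= ppow_rec_fuel //.
by rewrite leq_subLR -add1n leq_add2r expn_gt0 p_gt0.
Qed.

Lemma pfactor_leq k : (0 < k)%N -> (p ^ logn p k <= k)%N.
Proof. by move=> k0; rewrite dvdn_leq // pfactor_dvdnn. Qed.

Lemma ppow_ind (P : nat -> seq nat -> Prop) :
  P 0 [::] ->
  (forall k, (0 < k)%N -> P (k - p ^ logn p k)%N (ppow (k - p ^ logn p k)) ->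
     P k (logn p k :: ppow (k - p ^ logn p k))) ->
  forall k, P k (ppow k).
Proof.
move=> P0 PS k; have [n] := ubnP k; elim: n k => // n IHn [|k] ltkn //.
rewrite ppowE //; apply: PS => //; apply: IHn.
by rewrite -ltnS (leq_trans _ ltkn) // ltnS ltn_subrL expn_gt0 p_gt0.
Qed.

Lemma sum_ppow k : (\sum_(a <- ppow k) p ^ a)%N = k.
Proof.
apply: (@ppow_ind (fun k s => (\sum_(a <- s) p ^ a)%N = k)) k => [|k k0 IHk].
  by rewrite big_nil.
by rewrite big_cons IHk subnKC ?pfactor_leq.
Qed.

Lemma ppow_lt e k : (k < p ^ e)%N -> all (fun a => a < e)%N (ppow k).
Proof.
apply: (@ppow_ind (fun k s => (k < p ^ e)%N -> all (fun a => a < e)%N s)) k.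
  by [].
move=> k k0 IHk ltk /=.
rewrite -(ltn_exp2l _ _ (prime_gt1 p_pr)) (leq_ltn_trans (pfactor_leq k0)) //=.
by apply: IHk; apply: leq_ltn_trans (leq_subr _ _) ltk.
Qed.

Lemma size_ppow_small k : (k < p)%N -> size (ppow k) = k.
Proof.
move=> ltk; rewrite -[in RHS](sum_ppow k) -sum1_size big_seq [RHS]big_seq.
have /allP lt1 : all (fun a => a < 1)%N (ppow k) by rewrite ppow_lt ?expn1.
by apply: eq_bigr=> a /lt1; rewrite ltnS leqn0 => /eqP ->.
Qed.

Lemma ppowX a : ppow (p ^ a) = [:: a].
Proof. by rewrite ppowE ?expn_gt0 ?p_gt0 // pfactorK // subnn. Qed.

Lemma size_ppow_gt0 k : (0 < size (ppow k))%N = (0 < k)%N.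
Proof. by case: k. Qed.

Lemma coef_1DXn (F : fieldType) (k i : nat) :
  ((1 + 'X : {poly F}) ^+ k)`_i = 'C(k, i)%:R.
Proof.
rewrite exprDn (eq_bigr (fun j : 'I_k.+1 => 'C(k, j)%:R *: 'X^j)); last first.
  by move=> j _; rewrite expr1n mul1r scaler_nat.
rewrite -(poly_def _ (fun j => 'C(k, j)%:R)) coef_poly.
by case: ltnP => // lek; rewrite bin_small.
Qed.

(** By Lucas, the binomial coefficient is congruent to the lowest non-zero
   base p digit of k, that is to k / p ^ a modulo p. *)
Lemma bin_pfactor_neq0 (F : fieldType) k : p \in [pchar F] -> (0 < k)%N ->
  'C(k, p ^ logn p k)%:R != 0 :> F.
Proof.
move=> pF k0; have [k' ndvd ek] := pfactor_coprime p_pr k0.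
set P := (p ^ logn p k)%N in ek *.
have P0 : (0 < P)%N by rewrite expn_gt0 p_gt0.
rewrite -coef_1DXn [in X in _ ^+ X]ek mulnC exprM exprDn_pchar; last first.
  by rewrite pnatX pnatE // pchar_poly pF.
rewrite expr1n.
have -> : (1 + 'X^P) ^+ k' = (1 + 'X) ^+ k' \Po 'X^P :> {poly F}.
  by rewrite rmorphXn /= comp_polyD comp_polyC comp_polyX.
rewrite coef_comp_poly_Xn // dvdnn divnn P0 coef_1DXn bin1.
by rewrite -(dvdn_pcharf pF) -prime_coprime.
Qed.

Section Monomials.

Variable d : nat.
Implicit Types m : 'X_{1..d}.

Definition factors m : seq ('I_d * nat) :=
  [seq (i, a) | i <- enum 'I_d, a <- ppow (m i)].

(** The p-weight: the total of the base p digit sums of the exponents. *)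
Definition weight m : nat := size (factors m).

Lemma big_factors (R : Type) (idx : R) (op : Monoid.com_law idx) m
    (G : 'I_d -> nat -> R) :
  \big[op/idx]_(t <- factors m) G t.1 t.2 =
  \big[op/idx]_(i < d) \big[op/idx]_(a <- ppow (m i)) G i a.
Proof. by rewrite big_allpairs_dep big_enum. Qed.

Lemma weightE m : weight m = (\sum_i size (ppow (m i)))%N.
Proof.
rewrite /weight -sum1_size (big_factors _ _ (fun _ _ => 1%N)).
by apply: eq_bigr=> i _; rewrite sum1_size.
Qed.

Lemma sum_factors m : (\sum_(t <- factors m) p ^ t.2)%N = mdeg m.
Proof.
rewrite (big_factors _ _ (fun _ a => p ^ a)%N) mdegE.
by apply: eq_bigr=> i _; rewrite sum_ppow.
Qed.

Lemma prod_factors (R : comNzRingType) (x : 'I_d -> R) m :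
  \prod_i x i ^+ m i = \prod_(t <- factors m) x t.1 ^+ (p ^ t.2).
Proof.
rewrite (big_factors _ _ (fun i a => x i ^+ (p ^ a))).
by apply: eq_bigr=> i _; rewrite -expr_sum sum_ppow.
Qed.

Lemma factors_lt e m : (forall i, m i < p ^ e)%N ->
  {in factors m, forall t, (t.2 < e)%N}.
Proof.
by move=> bm t /allpairsPdep[i [a [_ ai ->]]]; apply: (allP (ppow_lt (bm i))).
Qed.

Lemma weight_small m : (forall i, m i < p)%N -> weight m = mdeg m.
Proof.
move=> sm; rewrite weightE mdegE; apply: eq_bigr=> i _.
by rewrite size_ppow_small.
Qed.

Lemma weight_gt0 m : (0 < weight m)%N = (m != 0%MM).
Proof.
rewrite weightE -mdeg_eq0 mdegE -lt0n; apply/idP/idP; rewrite !lt0n !sum_nat_eq0.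
  by apply: contra => /forallP m0; apply/forallP=> i; rewrite (eqP (m0 i)).
apply: contra => /forallP m0; apply/forallP=> i.
apply/implyP=> _; rewrite -leqn0 leqNgt -size_ppow_gt0 lt0n negbK.
exact: (implyP (m0 i)).
Qed.

(** [m] with the lowest power of p removed from its i-th exponent. *)
Definition peel (i : 'I_d) m := (m - U_(i) *+ (p ^ logn p (m i)))%MM.

Lemma peelK i m : (0 < m i)%N ->
  (peel i m + U_(i) *+ (p ^ logn p (m i)))%MM = m.
Proof.
move=> mi; apply/mnmP=> j; rewrite mnmDE mnmBE mulmnE mnm1E.
have [<-|_] := eqVneq i j; last by rewrite mul0n subn0 addn0.
by rewrite mul1n subnK ?pfactor_leq.
Qed.

Lemma peelE i m j :
  peel i m j = if j == i then (m i - p ^ logn p (m i))%N else m j.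
Proof.
rewrite mnmBE mulmnE mnm1E eq_sym; have [->|_] := eqVneq j i.
  by rewrite mul1n.
by rewrite mul0n subn0.
Qed.

Lemma weight_peel i m : (0 < m i)%N -> weight m = (weight (peel i m)).+1.
Proof.
move=> mi; rewrite !weightE (bigD1 i) //= [in RHS](bigD1 i) //= peelE eqxx.
rewrite ppowE //= addSn; congr (_ + _).+1; apply: eq_bigr=> j /negPf ji.
by rewrite peelE ji.
Qed.

End Monomials.

End PowerDecomposition.

(** * Coefficients of maps on a vector space *)

Section Mappings.

Variables (F : finFieldType) (V : vectType F).
Local Notation dim := (\dim {:V}).
Local Notation point := {ffun 'I_dim -> F}.
Implicit Types (alpha beta : V -> F) (b : dim.-tuple V) (m : 'X_{1..dim}).

Definition comb b (a : 'I_dim -> F) : V := \sum_i a i *: tnth b i.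

Lemma eq_comb b a a' : a =1 a' -> comb b a = comb b a'.
Proof. by move=> e; apply: eq_bigr=> i _; rewrite e. Qed.

Lemma combZ b c a : c *: comb b a = comb b (fun i => c * a i).
Proof. by rewrite scaler_sumr; apply: eq_bigr=> i _; rewrite scalerA. Qed.

Lemma comb_along b (a : point) i t :
  comb b (a + along i t) = t *: tnth b i + comb b a.
Proof.
rewrite [_ + along _ _]addrC /comb (bigD1 i) //= [in RHS](bigD1 i) //= !ffunE eqxx.
rewrite scalerDl -!addrA; do 2!congr (_ + _); apply: eq_bigr=> j ji.
by rewrite !ffunE (negPf ji) add0r.
Qed.

Lemma coord_comb b a i : basis_of {:V} b -> coord b i (comb b a) = a i.
Proof.
move=> /basis_free fb; rewrite /comb.
under eq_bigr => j _ do rewrite (tnth_nth 0).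
by rewrite coord_sum_free.
Qed.

Lemma comb_coord b v : basis_of {:V} b -> comb b (fun i => coord b i v) = v.
Proof.
move=> bb; rewrite [RHS](coord_basis bb (memvf v)).
by apply: eq_bigr=> i _; rewrite (tnth_nth 0).
Qed.

Definition coef b m alpha : F := coefm m (fun a : point => alpha (comb b a)).

Lemma realizes_coefE b f alpha m : reduced f -> realizes b f alpha ->
  f@_m = coef b m alpha.
Proof.
move=> rf raf; rewrite -(coefm_bounded m rf).
by apply: eq_coefm=> a; rewrite -raf.
Qed.

Lemma exists_reduced b alpha :
  exists f : {mpoly F[dim]}, reduced f /\ realizes b f alpha.
Proof.
exists (interpolant (fun a : point => alpha (comb b a))).
split=> [|a]; first exact: interpolant_bounded.
rewrite (@meval_eq _ _ _ (finfun a)) => [|i]; last by rewrite ffunE.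
by rewrite interpolantE; congr alpha; apply: eq_comb=> i; rewrite ffunE.
Qed.

Lemma eq_defect n alpha (u w : 'I_n -> V) : u =1 w ->
  defect alpha u = defect alpha w.
Proof.
move=> e; apply: eq_bigr=> I _; congr (_ * alpha _).
by apply: eq_bigr=> i _.
Qed.

Section Degree.

Variables (p e : nat).
Hypotheses (p_pr : prime p) (cardF : #|F| = (p ^ e)%N).

Let pF : p \in [pchar F] := card_finPcharP cardF p_pr.

(** Polarizing in the direction of a basis vector and extracting the
   coefficient of t ^ (p ^ a), where p ^ a is the lowest power of p in m i,
   turns the coefficient of m into a non-zero multiple of itself at
   [peel i m], while the defect loses one argument. *)
Lemma weight_le_defect b k alpha :
  (forall u : 'I_k.+1 -> V, defect alpha u = 0) ->
  forall m, bounded_exps F m -> m != 0%MM -> coef b m alpha != 0 ->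
  (weight p m <= k)%N.
Proof.
elim: k alpha => [|k IHk] alpha alpha0 m bm m0.
  case/eqP; rewrite /coef (@eq_coefm _ _ _ _ (fun=> 0 * 0)) => [|a].
    by rewrite coefmZ mul0r.
  by rewrite mul0r -(defect1 alpha (fun=> comb b a)) alpha0.
apply: contraNT; rewrite -ltnNge => ltkm.
have [i mi] : exists i, (0 < m i)%N.
  apply/existsP; apply: contraNT m0; rewrite negb_exists => /forallP mi.
  by apply/eqP/mnmP=> i; rewrite mnm0E; apply/eqP; rewrite -leqn0 leqNgt.
set s := (p ^ logn p (m i))%N; pose m' := peel p i m.
have m'K : (m' + U_(i) *+ s)%MM = m := peelK p mi.
have es : (m' i + s)%N = m i by rewrite peelE eqxx subnK ?pfactor_leq.
rewrite (weight_peel p_pr mi) ltnS in ltkm.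
have m'0 : m' != 0%MM by rewrite -(weight_gt0 p) (leq_ltn_trans _ ltkm).
have bm' : bounded_exps F m'.
  move=> j; rewrite peelE; case: eqP => _ //.
  exact: leq_ltn_trans (leq_subr _ _) (bm i).
have coef0 t : coef b m' (polar (t *: tnth b i) alpha) = 0.
  apply/eqP; apply: contraTT ltkm; rewrite -leqNgt => nz.
  apply: (IHk _ _ m' bm' m'0 nz) => w.
  pose u j := if unlift ord0 j is Some j' then w j' else t *: tnth b i.
  rewrite -(alpha0 u) defectS {1}/u unlift_none; apply: eq_defect=> j.
  by rewrite /u liftK.
have : \sum_t dual s t * coef b m' (polar (t *: tnth b i) alpha) = 0.
  by rewrite big1 // => t _; rewrite coef0 mulr0.
have lts : (m' i + s < #|F|)%N by rewrite es.
pose g (a : point) := alpha (comb b a).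
have const0 (c : F) : coefm m' (fun=> c) = 0.
  rewrite (@eq_coefm _ _ _ _ (fun a : point =>
              c * \prod_j a j ^+ (0%MM : 'X_{1..dim}) j)); last first.
    by move=> a; rewrite big1 ?mulr1 // => j _; rewrite mnm0E.
  rewrite coefmZ coefm_monomial redm_id; last first.
    by move=> j; rewrite mnm0E ffcard_gt0.
  by rewrite (negPf m'0) mulr0.
rewrite (eq_bigr (fun t => dual s t * coefm m' (fun a => g (a + along i t)) -
                           dual s t * t ^+ 0 * coefm m' g)); last first.
  move=> t _; rewrite expr0 mulr1 -mulrBr; congr (_ * _).
  transitivity (coefm m' (fun a => g (a + along i t) +
      (-1 * g a + -1 * alpha (t *: tnth b i)))).
    apply: eq_coefm=> a; rewrite /polar /g comb_along !mulN1r addrA.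
    by congr (_ - _ - _); congr alpha.
  by rewrite coefmD coefmD !coefmZ const0 mulr0 addr0 mulN1r.
rewrite sumrB -mulr_suml coefm_along // dual_expr ?ffcard_gt0 // es m'K.
rewrite eqn0Ngt expn_gt0 prime_gt0 // mul0r subr0 => /eqP.
by rewrite mulf_eq0 (negPf (bin_pfactor_neq0 p_pr pF mi)).
Qed.

Lemma expr_ppow_additive a (i : 'I_dim) b :
  {morph (fun v => coord b i v ^+ (p ^ a)) : x y / x + y}.
Proof. by move=> x y /=; rewrite linearD exprDn_pchar // pnatX pnatE // pF. Qed.

Lemma realizes_monomialE b m c beta : basis_of {:V} b ->
  realizes b (c *: 'X_[m]) beta ->
  forall v, beta v = c * \prod_i coord b i v ^+ m i.
Proof.
by move=> bb rb v; rewrite -[v in LHS](comb_coord v bb) rb mevalZ mevalX.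
Qed.

Lemma monomial_realizes b m c : basis_of {:V} b ->
  realizes b (c *: 'X_[m]) (fun v => c * \prod_i coord b i v ^+ m i).
Proof.
move=> bb a; rewrite mevalZ mevalX; congr (_ * _); apply: eq_bigr=> i _.
by rewrite (coord_comb a i bb).
Qed.

Lemma coef_monomial b m c beta m' : bounded_exps F m ->
  realizes b (c *: 'X_[m]) beta -> coef b m' beta = c * (m' == m)%:R.
Proof.
move=> bm rb; rewrite -(@redm_id F _ m) // -coefm_monomial -coefmZ.
by apply: eq_coefm=> a; rewrite [beta _]rb mevalZ mevalX.
Qed.

(** A monomial is a product of [weight m] additive maps: each power of p in
   the base p expansion of an exponent contributes a Frobenius power of a
   coordinate. *)
Lemma defect_monomial b m c beta n (u : 'I_n -> V) : basis_of {:V} b ->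
  realizes b (c *: 'X_[m]) beta -> m != 0%MM -> (weight p m < n)%N ->
  defect beta u = 0.
Proof.
move=> bb rb m0 ltn.
rewrite -(defect_prod u (fun t => expr_ppow_additive t.2 t.1 b) c
            (s := factors p m)) ?weight_gt0 ?m0 //.
apply: eq_bigr=> I _; congr (_ * _).
by rewrite (realizes_monomialE bb rb) (prod_factors p_pr).
Qed.

Lemma cdeg_monomial b m c beta : basis_of {:V} b ->
  realizes b (c *: 'X_[m]) beta -> bounded_exps F m -> m != 0%MM -> c != 0 ->
  is_cdeg beta (weight p m)%:Z.
Proof.
move=> bb rb bm m0 c0; right; exists (weight p m).
split; rewrite ?weight_gt0 //; last first.
  by move=> u; apply: defect_monomial rb m0 _.
apply: NNPP => nex; have := m0; rewrite -(weight_gt0 p).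
case ew: (weight p m) nex => [|k] // nex _.
have : (weight p m <= k)%N; last by rewrite ew ltnn.
apply: (@weight_le_defect b _ beta) => // [u|].
  by apply/eqP/negPn/negP=> nz; apply: nex; exists u.
by rewrite (coef_monomial _ bm rb) eqxx mulr1.
Qed.

Lemma weight_le_Pn n b alpha m : Pn n alpha ->
  bounded_exps F m -> m != 0%MM -> coef b m alpha != 0 -> (weight p m <= n)%N.
Proof.
case=> _ _ [c [[[alpha0 _]|[k [k0 ec _ dk]]] lecn]] bm m0 nz.
  case/eqP: nz; rewrite /coef (@eq_coefm _ _ _ _ (fun=> 0 * 0)) => [|a].
    by rewrite coefmZ mul0r.
  by rewrite mul0r alpha0.
apply: leq_trans (weight_le_defect dk bm m0 nz) _.
by rewrite ec lez_nat in lecn.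
Qed.

End Degree.

(** The class of maps defined by congruences of degrees does not depend on
   the basis, since it consists of the maps that scale by n-th powers. *)
Lemma scaling_of_Pequiv n alpha : (0 < n)%N -> Pequiv n alpha ->
  forall c v, alpha (c *: v) = c ^+ n * alpha v.
Proof.
move=> n0 [_ [b [bb degb]]] c v.
have [f [rf raf]] := exists_reduced b alpha.
rewrite -(comb_coord v bb) combZ [LHS]raf [X in _ * X]raf !mevalE mulr_sumr.
rewrite big_seq [RHS]big_seq; apply: eq_bigr=> m mf.
rewrite mulrCA; congr (_ * _).
have [/eqP m0 em] : mdeg m <> 0%N /\ (mdeg m = n %[mod #|F| - 1])%N.
  apply: degb (_ : monomial_of b alpha m
                     (fun v => f@_m * \prod_i coord b i v ^+ m i)).
  by exists f; split=> //; apply: monomial_realizes.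
rewrite -lt0n in m0.
rewrite -((expr_modP F m0 n0).2 em c) mdegE -prodrXr -big_split /=.
by apply: eq_bigr=> i _; rewrite exprMn.
Qed.

Lemma degree_of_scaling n alpha b m : (0 < n)%N ->
  (forall c v, alpha (c *: v) = c ^+ n * alpha v) ->
  bounded_exps F m -> coef b m alpha != 0 ->
  mdeg m <> 0%N /\ (mdeg m = n %[mod #|F| - 1])%N.
Proof.
move=> n0 sc bm nz.
have [f [rf raf]] := exists_reduced b alpha.
have eqpow (c : F) : c ^+ mdeg m = c ^+ n.
  apply: (mulIf nz); rewrite -[RHS]coefmZ.
  transitivity (coefm m (fun a : point => \sum_(mu <- msupp f)
      (f@_mu * c ^+ mdeg mu) * \prod_i a i ^+ mu i)); last first.
    apply: eq_coefm=> a; rewrite -sc combZ [RHS]raf mevalE.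
    apply: eq_bigr=> mu _; rewrite -mulrA; congr (_ * _).
    rewrite mdegE -prodrXr -big_split.
    by apply: eq_bigr=> i _ /=; rewrite exprMn.
  rewrite coefm_sum -(realizes_coefE m rf raf) -(coefm_bounded m rf).
  rewrite coefm_meval mulr_sumr big_seq [RHS]big_seq; apply: eq_bigr=> mu muf.
  rewrite coefmZ coefm_monomial redm_id; last exact: rf.
  by have [->|_] := eqVneq m mu; rewrite ?mulr0 // !mulr1 mulrC.
have m0 : mdeg m <> 0%N.
  move=> m0; move: (eqpow 0); rewrite m0 expr0 expr0n gtn_eqF //.
  by move/eqP; rewrite oner_eq0.
split=> //; apply/(expr_modP F) => //.
by rewrite lt0n; apply/eqP.
Qed.

Lemma dhomog_prodX (R : comNzRingType) k (I : Type) (r : seq I)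
    (f : I -> {mpoly R[k]}) (h : I -> nat) :
  (forall i, f i \is 1.-homog) ->
  \prod_(i <- r) f i ^+ h i \is (\sum_(i <- r) h i).-homog.
Proof.
move=> hf; elim/big_rec2: _ => [|i n g _ hg]; first exact: dhomog1.
by apply: dhomogM => //; have := dhomogMn (h i) (hf i); rewrite mul1n.
Qed.

(** Coordinates in one basis are linear forms in those of another. *)
Lemma homogeneous_change_basis n alpha b : homogeneous_polynomial n alpha ->
  exists f : {mpoly F[dim]}, f \is n.-homog /\ realizes b f alpha.
Proof.
case=> b' [bb' [f [hf raf]]].
pose l : dim.-tuple {mpoly F[dim]} :=
  [tuple \sum_i coord b' j (tnth b i) *: 'X_i | j < dim].
exists (f \mPo l); split.
  rewrite comp_mpolyE big_seq rpred_sum // => m mf.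
  rewrite dhomogZ // -(dhomog_mf hf mf : mdeg m = n) mdegE.
  apply: dhomog_prodX => j.
  rewrite tnth_mktuple rpred_sum // => i _.
  by rewrite dhomogZ // dhomogX; apply/eqP/mdeg1.
move=> a; rewrite comp_mpoly_meval -raf -[LHS]/(alpha (comb b a)).
congr alpha; rewrite -[LHS](comb_coord _ bb'); apply: eq_bigr=> j _.
congr (_ *: _); rewrite tnth_mktuple raddf_sum linear_sum.
by apply: eq_bigr=> i _; rewrite /= mevalZ mevalXU linearZ mulrC.
Qed.

Lemma homogeneous_coef n alpha b m : homogeneous_polynomial n alpha ->
  coef b m alpha != 0 -> (mdeg m <= n)%N.
Proof.
move=> /(homogeneous_change_basis b)[f [hf raf]]; apply: contraNT.
rewrite -ltnNge => ltn; apply/eqP.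
rewrite /coef (@eq_coefm _ _ _ _ (fun a : point => f.@[a])) => [|a]; last first.
  exact: raf.
rewrite coefm_meval big_seq big1 // => mu muf.
have := mdeg_redm F mu; rewrite (dhomog_mf hf muf : mdeg mu = n).
case: eqP=> [<-|_]; last by rewrite mulr0.
by rewrite leqNgt ltn.
Qed.

End Mappings.

(** * Low degrees *)

(** A weight below n < 5 bounds the degree by (n - 1) * p ^ (e - 1), which is
   less than n + (q - 1), the next degree that is congruent to n, unless p = 2
   and n = 4.  In that case the degree is a sum of three powers of two which
   would have to be the odd number 2 ^ e + 3: one power is 1, and the others
   are at most 2 ^ (e - 1). *)
Lemma sum_powers_le p e n (s : seq nat) :
  prime p -> (0 < e)%N -> (n < 5)%N -> all (fun a => a < e)%N s ->
  (size s < n)%N ->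
  (\sum_(a <- s) p ^ a = n %[mod p ^ e - 1])%N ->
  (\sum_(a <- s) p ^ a <= n)%N.
Proof.
case: e => // e p_pr _ n5 lte ltn eqD; set D := (\sum_(a <- s) p ^ a)%N in eqD *.
have p2 := prime_gt1 p_pr; pose P := (p ^ e)%N.
have P0 : (0 < P)%N by rewrite expn_gt0 prime_gt0.
have leP a : (a < e.+1)%N -> (p ^ a <= P)%N by move=> lta; rewrite leq_exp2l.
have leD : (D <= size s * P)%N.
  rewrite -sum1_size big_distrl /= /D big_seq [leqRHS]big_seq.
  by apply: leq_sum=> a /(allP lte) lta; rewrite mul1n leP.
rewrite leqNgt; apply/negP=> ltnD.
have [k eqk] : exists k, (D - n = k * (p * P - 1))%N.
  by apply/dvdnP; rewrite -expnS -eqn_mod_dvd ?(ltnW ltnD) //; apply/eqP.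
have k0 : (0 < k)%N by case: k eqk => // /eqP; rewrite mul0n subn_eq0 leqNgt ltnD.
clearbody P; have [p3|p3] := ltnP 2 p; first by nia.
have {p2 p3} ep : p = 2%N by lia.
have [s2|s3] := leqP (size s) 2; first by nia.
have es : size s = 3%N by lia.
have en : n = 4%N by lia.
rewrite es en ep in eqk leD ltnD *.
have k1 : (k < 2)%N by rewrite ltnNge; apply/negP=> k2; nia.
have eD : D = (2 * P + 3)%N by nia.
move: lte es eD; rewrite /D ep {k k1 eqk k0 leD ltnD eqD D}.
case: s {s3 ltn} => [|a [|b [|c [|? ?]]]] //=.
rewrite !big_cons big_nil addn0 andbT => /and3P[/leP]; rewrite ep.
move=> la /leP lb /leP lc _; rewrite ep in lb lc.
case: a la => [|a] la; first by rewrite expn0; lia.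
case: b lb => [|b] lb; first by rewrite expn0; lia.
case: c lc => [|c] lc; first by rewrite expn0; lia.
by rewrite !expnS; lia.
Qed.

Lemma exists_pad_exponent (F : finFieldType) d (m : 'X_{1..d}) n :
  mdeg m <> 0%N -> (mdeg m <= n)%N -> (mdeg m = n %[mod #|F| - 1])%N ->
  exists m' : 'X_{1..d}, mdeg m' = n /\
    forall x : 'I_d -> F, \prod_i x i ^+ m' i = \prod_i x i ^+ m i.
Proof.
move=> /eqP m0 len /esym/eqP; rewrite eqn_mod_dvd // subn1 => /dvdnP[k ek].
have [i mi] : exists i, (0 < m i)%N.
  apply/existsP; apply: contraNT m0; rewrite negb_exists => /forallP mi.
  rewrite mdegE sum_nat_eq0; apply/forallP=> i; apply/implyP=> _.
  by rewrite -leqn0 leqNgt.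
exists (m + U_(i) *+ (k * #|F|.-1))%MM; split.
  by rewrite mdegD mdegMn mdeg1 mul1n -ek subnKC.
move=> x; apply: eq_bigr=> j _; rewrite mnmDE mulmnE mnm1E.
have [<-|_] := eqVneq i j; last by rewrite mul0n addn0.
by rewrite mul1n exprMpred.
Qed.

Section Main.

Variables (F : finFieldType) (V : vectType F) (p e : nat).
Local Notation dim := (\dim {:V}).
Hypotheses (p_pr : prime p) (e_gt0 : (0 < e)%N) (cardF : #|F| = (p ^ e)%N).

Lemma homogeneous_of_degrees n (b : dim.-tuple V) (f : {mpoly F[dim]})
    (alpha : V -> F) :
  basis_of {:V} b -> realizes b f alpha ->
  {in msupp f, forall m, [/\ mdeg m <> 0%N, (mdeg m <= n)%N &
                             (mdeg m = n %[mod #|F| - 1])%N]} ->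
  homogeneous_polynomial n alpha.
Proof.
move=> bb raf degf; exists b; split=> //.
suff [g [hg eg]] : exists g : {mpoly F[dim]}, g \is n.-homog /\
    forall x, g.@[x] = \sum_(m <- msupp f) f@_m * \prod_i x i ^+ m i.
  by exists g; split=> // a; rewrite raf eg mevalE.
elim: (msupp f) degf => [|m s IHs] degs.
  by exists 0; split=> [|x]; rewrite ?rpred0 // meval0 big_nil.
have [m0 len em] := degs m (mem_head _ _).
have [|g [hg eg]] := IHs.
  by move=> m' m's; apply: degs; rewrite inE m's orbT.
have [m' [dm' em']] := exists_pad_exponent m0 len em.
exists (f@_m *: 'X_[m'] + g); split=> [|x].
  by rewrite rpredD // dhomogZ // dhomogX; apply/eqP.
by rewrite mevalD mevalZ mevalX em' eg big_cons.
Qed.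

Lemma homogeneous_low_degree n (alpha : V -> F) : (0 < n < 5)%N ->
  Pt n alpha -> Pequiv n alpha -> homogeneous_polynomial n alpha.
Proof.
move=> /andP[n0 n5] [Pn_alpha [b [bb tr]]] /(scaling_of_Pequiv n0) sc.
have [f [rf raf]] := exists_reduced b alpha.
apply: (homogeneous_of_degrees bb raf) => m mf.
have bm : bounded_exps F m := rf m mf.
have nz : coef b m alpha != 0.
  by rewrite -(realizes_coefE m rf raf) -mcoeff_msupp.
have [m0 em] := degree_of_scaling n0 sc bm nz; split=> //.
have m0' : m != 0%MM by rewrite -mdeg_eq0; apply/eqP.
have := weight_le_Pn p_pr cardF Pn_alpha bm m0' nz.
rewrite leq_eqVlt => /orP[/eqP ew|ltw].
  pose beta v := f@_m * \prod_i coord b i v ^+ m i.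
  have rb : realizes b (f@_m *: 'X_[m]) beta by apply: monomial_realizes.
  rewrite -ew (weight_small p_pr) //.
  apply: (tr m beta _ _ p (card_finPcharP cardF p_pr)); first by exists f.
  rewrite -ew; apply: (cdeg_monomial p_pr cardF bb rb bm m0').
  by rewrite -mcoeff_msupp.
rewrite -(sum_factors p_pr) -(big_map snd predT (fun a => p ^ a)%N).
apply: (@sum_powers_le _ e) => //; rewrite ?size_map //.
  apply/allP=> _ /mapP[t tm ->]; apply: (factors_lt p_pr _ tm) => i.
  by rewrite -cardF.
by rewrite big_map sum_factors // -cardF.
Qed.

(** * High degrees *)

Section HighDegree.

Variables (n : nat).
Hypotheses (n_ge5 : (5 <= n)%N) (n_geq : (p ^ e <= n)%N) (e_ge2 : (2 <= e)%N)
  (n_led : (n <= dim)%N).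

Let p_gt1 : (1 < p)%N := prime_gt1 p_pr.

(** The p + 2 raised variables have to be among the n - p + 1 ones; for p = 2
   this is the bound n >= 5. *)
Let n_ge2p1 : (2 * p + 1 <= n)%N.
Proof.
have : (p ^ 2 <= p ^ e)%N by rewrite leq_exp2l.
by rewrite expnS expn1; case: (ltnP 2 p) => hp; nia.
Qed.

(** n - p + 1 variables with exponents powers of p: starting from exponents 1,
   whose total n - p + 1 is p - 1 short of n, two of them are raised to p,
   which adds 2 * (p - 1), and p of them to p ^ (e - 1), which adds q - p; the
   total becomes n + q - 1. *)
Definition high_exp (i : nat) : nat :=
  (if i < p then p ^ e.-1
   else if i < p + 2 then p
   else if i < n - p + 1 then 1 else 0)%N.

Definition high_mon : 'X_{1..dim} := [multinom high_exp i | i < dim].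

Lemma high_exp_lt i : (high_exp i < #|F|)%N.
Proof.
have lt1 : (1 < #|F|)%N := finNzRing_gt1 F.
rewrite /high_exp; case: ifP => _.
  by rewrite cardF ltn_exp2l // ltn_predL.
case: ifP => _; first by rewrite cardF -{1}(expn1 p) ltn_exp2l.
by case: ifP => // _; apply: ltnW.
Qed.

Lemma mdeg_high_mon : mdeg high_mon = (n + (#|F| - 1))%N.
Proof.
have h1 : (p + 2 <= n - p + 1)%N by lia.
have h2 : (n - p + 1 <= dim)%N by lia.
rewrite mdegE (eq_bigr (fun i : 'I_dim => high_exp i)) => [|i _]; last first.
  by rewrite mnmE.
rewrite -(big_mkord predT high_exp).
rewrite (@big_cat_nat _ _ _ (n - p + 1)) //= (@big_cat_nat _ _ _ (p + 2)) //=.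
rewrite (@big_cat_nat _ _ _ p) ?leq_addr //=.
rewrite (eq_big_nat _ _ (F2 := fun=> p ^ e.-1)%N); last first.
  by move=> i /andP[_ lti]; rewrite /high_exp lti.
rewrite [X in (_ + X + _ + _)%N](eq_big_nat _ _ (F2 := fun=> p)); last first.
  by move=> i /andP[lei lti]; rewrite /high_exp lti ltnNge lei.
rewrite [X in (_ + X + _)%N](eq_big_nat _ _ (F2 := fun=> 1%N)); last first.
  move=> i /andP[lei lti].
  rewrite /high_exp lti ltnNge (leq_trans _ lei) ?leq_addr //=.
  by rewrite ltnNge lei.
rewrite [X in (_ + X)%N](eq_big_nat _ _ (F2 := fun=> 0%N)); last first.
  move=> i /andP[lei lti]; rewrite /high_exp !ltnNge lei (leq_trans h1 lei) /=.
  by rewrite (leq_trans (leq_addr 2 p) (leq_trans h1 lei)).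
rewrite !sum_nat_const_nat cardF -(ltn_predK e_gt0) expnS /=.
have : (0 < p ^ e.-1)%N by rewrite expn_gt0 prime_gt0.
by nia.
Qed.

Lemma weight_high_mon : weight p high_mon = (n - p + 1)%N.
Proof.
have h2 : (n - p + 1 <= dim)%N by lia.
rewrite weightE.
rewrite (eq_bigr (fun i : 'I_dim => (i < n - p + 1)%N : nat)); last first.
  move=> i _; rewrite mnmE /high_exp.
  case: ltnP => [ltip|leip]; first by rewrite (ppowX p_pr) /=; lia.
  case: ltnP => [ltip|leip2].
    by rewrite -{2}(expn1 p) (ppowX p_pr) /=; lia.
  by case: ltnP => _ //; rewrite -(expn0 p) (ppowX p_pr).
rewrite -(big_mkord predT (fun i => (i < n - p + 1)%N : nat)).
rewrite (@big_cat_nat _ _ _ (n - p + 1)) //=.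
rewrite (eq_big_nat _ _ (F2 := fun=> 1%N)) => [|i /andP[_ ->] //].
rewrite [X in (_ + X)%N](eq_big_nat _ _ (F2 := fun=> 0%N)); last first.
  by move=> i /andP[lei _]; rewrite ltnNge lei.
by rewrite !sum_nat_const_nat; lia.
Qed.

Lemma high_degree_counterexample :
  exists alpha : V -> F, [/\ Pt n alpha, Pequiv n alpha &
                             ~ homogeneous_polynomial n alpha].
Proof.
pose b := vbasis {:V}; have bb : basis_of {:V} b := vbasisP _.
pose alpha v := 1 * \prod_i coord b i v ^+ high_mon i : F.
have ra : realizes b (1 *: 'X_[high_mon]) alpha by apply: monomial_realizes.
have bm : bounded_exps F high_mon by move=> i; rewrite mnmE high_exp_lt.
have q1 := finNzRing_gt1 F.
have ltw : (weight p high_mon < n)%N by rewrite weight_high_mon; lia.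
have m0 : high_mon != 0%MM by rewrite -mdeg_eq0 mdeg_high_mon; lia.
have only m beta : monomial_of b alpha m beta -> m = high_mon.
  case=> f [rf raf mf _]; apply/eqP; move: mf; rewrite mcoeff_msupp.
  rewrite (realizes_coefE m rf raf) (coef_monomial m bm ra) mul1r.
  by case: (m == _); rewrite // mulr0n eqxx.
have pol : polynomial_mapping alpha by exists b; split=> //; eexists; exact: ra.
exists alpha; split.
- split.
    split=> //.
      have [i] : exists i, high_mon i != 0%N.
        apply/existsP; apply: contraNT m0; rewrite negb_exists => /forallP mi.
        by apply/eqP/mnmP=> i; rewrite mnm0E; apply/eqP/negPn.
      rewrite /alpha (bigD1 i) //= linear0 expr0n => /negPf ->.
      by rewrite mul0r mulr0.
    exists (weight p high_mon)%:Z; split; last by rewrite lez_nat ltnW.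
    exact: (cdeg_monomial p_pr cardF bb ra bm m0 (oner_neq0 _)).
  exists b; split=> // m beta mon.
  have em := only m beta mon; case: mon => f [_ _ _]; rewrite em => rb.
  case=> [[_ //]|[k [_ [<-] [u /eqP[]]]]].
  exact: (defect_monomial p_pr cardF _ bb rb m0 ltw).
- split=> //; exists b; split=> // m beta /only ->.
  by rewrite mdeg_high_mon modnDr; split=> //; lia.
move/(homogeneous_coef (b := b) (m := high_mon)).
rewrite (coef_monomial _ bm ra) eqxx mulr1 oner_neq0 mdeg_high_mon => /(_ isT).
by rewrite leqNgt -[ltnLHS]addn0 ltn_add2l subn_gt0 q1.
Qed.

End HighDegree.

End Main.

Theorem proposition6p3 (F : finFieldType) (q p e : nat) (V : vectType F)
    (d n : nat) (hq : #|F| = q) (hqpe : q = (p ^ e)%N) (hp : prime p)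
    (he : (1 <= e)%N) (hd : \dim {:V} = d) (hn : (1 <= n)%N) :
  ((n < 5)%N ->
     forall alpha : V -> F, Pt n alpha -> Pequiv n alpha ->
       homogeneous_polynomial n alpha) /\
  ((maxn 5 q <= n)%N -> (2 <= e)%N -> (n <= d)%N ->
     ~ (forall alpha : V -> F, Pt n alpha -> Pequiv n alpha ->
          homogeneous_polynomial n alpha)).
Proof.
have cardF : #|F| = (p ^ e)%N by rewrite hq.
split=> [n5 alpha|].
  by apply: (homogeneous_low_degree hp he cardF); rewrite hn.
rewrite geq_max => /andP[n_ge5 n_geq] e_ge2 n_led all_homog.
rewrite hqpe in n_geq; rewrite -hd in n_led.
have [alpha [Pt_alpha Peq_alpha]] :=
  high_degree_counterexample hp he cardF n_ge5 n_geq e_ge2 n_led.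
by apply; apply: all_homog.
Qed.
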